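(* If $\rho_1\rho_2=r^2$, then for every $y\in B$, $$P_y(\tau<\infty)={\bm h}_r(y)+\frac{1-r}{1-\rho_2/r}\,h_{\rho_1}(y),$$ where ${\bm h}_r(y)=r^{y(1)-y(2)}-\frac{1-r}{1-\rho_2/r}\,r^{y(1)-y(2)}\left(\frac{r^2}{\rho_2}\right)^{y(2)}$ and $h_{\rho_1}(y)=\rho_1^{y(1)}$.
   Context: Parameters: $\lambda_1,\lambda_2,\mu_1,\mu_2>0$ with $\lambda_1+\lambda_2+\mu_1+\mu_2=1$; $\rho_i=\lambda_i/\mu_i$, $r=(\lambda_1+\lambda_2)/(\mu_1+\mu_2)$. Standing assumptions: $\rho_1,\rho_2<1$, $\rho_2\le r\le\rho_1$, $\rho_1\ne\rho_2$, $r^2/\rho_2<1$. $Y$ is the random walk on $\mathbb{Z}\times\mathbb{Z}_+$ with i.i.d. increments $J_k$, $P(J_k=(-1,0))=\lambda_1$, $P(J_k=(1,0))=\mu_1$, $P(J_k=(0,1))=\lambda_2$, $P(J_k=(0,-1))=\mu_2$: it moves by the next increment if this keeps it in $\mathbb{Z}\times\mathbb{Z}_+$, and otherwise does not move. $B=\{y\in\mathbb{Z}\times\mathbb{Z}_+: y(1)\ge y(2)\}$, $\partial B=\{y\in\mathbb{Z}\times\mathbb{Z}_+:y(1)=y(2)\}$, $\tau=\inf\{k\ge0:Y_k\in\partial B\}$, and $P_y$ is the law of $Y$ started at $y$. *)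

(* Defs.v *)
From HB Require Import structures.
From mathcomp Require Import all_boot all_order all_algebra finmap.
From mathcomp Require Import all_classical all_reals all_analysis.

Set Implicit Arguments.
Unset Strict Implicit.
Unset Printing Implicit Defensive.

Import Order.TTheory GRing.Theory Num.Theory.

Local Open Scope classical_set_scope.
Local Open Scope ring_scope.

HB.instance Definition _ := isPointed.Build int 0.

(* int carries the discrete sigma-algebra, hence int * int the product one,
   which is again discrete since int is countable. *)
HB.instance Definition _ := @isMeasurable.Build default_measure_display
  int discrete_measurable discrete_measurable0
  discrete_measurableC discrete_measurableU.

Definition independent_family d (T : measurableType d) d' (T' : measurableType d')
    (R : realType) (P : probability T R) (X : nat -> {RV P >-> T'}) : Prop :=
  forall (I : {fset nat}) (A : nat -> set T'),
    (forall i, i \in I -> measurable (A i)) ->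
    P (\bigcap_(i in [set` I]) (X i @^-1` A i)) =
    (\prod_(i <- enum_fset I) P (X i @^-1` A i))%E.

Definition half_plane : set (int * int) := [set y | 0 <= y.2].

Definition regionB : set (int * int) := half_plane `&` [set y | y.2 <= y.1].

Definition boundaryB : set (int * int) := half_plane `&` [set y | y.1 = y.2].

Definition step (y j : int * int) : int * int :=
  if (y + j) \in half_plane then y + j else y.

Fixpoint walk (T : Type) (J : nat -> T -> int * int) (y : int * int)
    (k : nat) (w : T) : int * int :=
  if k is k'.+1 then step (walk J y k' w) (J k' w) else y.

(* Equal to +oo exactly on the paths that never reach the diagonal. *)
Definition tau (R : realType) (T : Type) (J : nat -> T -> int * int)
    (y : int * int) (w : T) : \bar R :=
  ereal_inf [set (k%:R)%:E | k in [set k : nat | boundaryB (walk J y k w)]].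

Definition increment_law (R : realType) (lambda1 lambda2 mu1 mu2 : R)
    d (T : measurableType d) (P : probability T R)
    (X : {RV P >-> (int * int)%type}) : Prop :=
  [/\ distribution P X [set (-1, 0)] = lambda1%:E,
      distribution P X [set (1, 0)] = mu1%:E,
      distribution P X [set (0, 1)] = lambda2%:E &
      distribution P X [set (0, -1)] = mu2%:E].

Definition bold_h (R : realType) (rho2 r : R) (y : int * int) : R :=
  r ^ (y.1 - y.2)
  - (1 - r) / (1 - rho2 / r) * r ^ (y.1 - y.2) * (r ^+ 2 / rho2) ^ y.2.

Definition h_rho (R : realType) (rho1 : R) (y : int * int) : R := rho1 ^ y.1.

(* Main.v *)
(** First-step analysis: u_n(y) = P_y(tau <= n) satisfies u_{n+1} = L u_n off the
diagonal, where L averages over one step, and u_n increases to P_y(tau < oo).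
The candidate h is nonnegative and L-harmonic off the diagonal and equals 1 on
it, so u_n <= h by induction. For the converse, pick s in ]rho1, 1[: both
s^(y1 - y2) (away from the floor y2 = 0) and s^(y1) (everywhere) are contracted
by L, so for M large V = s^(y1 - y2) + M s^(y1) satisfies L V <= q V with q < 1,
the M-term absorbing the failure of the first one at the floor. As h <= V, one
gets h <= u_n + q^n V for all n. *)

Require Import Defs.
From HB Require Import structures.
From mathcomp Require Import all_boot all_order all_algebra finmap.
From mathcomp Require Import all_classical all_reals all_analysis.
From mathcomp Require Import ring lra zify.

Set Implicit Arguments.
Unset Strict Implicit.
Unset Printing Implicit Defensive.

Import Order.TTheory GRing.Theory Num.Theory.
Import numFieldNormedType.Exports.

Local Open Scope classical_set_scope.
Local Open Scope ring_scope.

(** * One-step averages of the walk in wedge coordinates *)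

Definition step_mean (R : realType) (l1 l2 m1 m2 : R)
    (f : int * int -> R) (y : int * int) : R :=
  l1 * f (step y (-1, 0)) + m1 * f (step y (1, 0)) +
  l2 * f (step y (0, 1)) + m2 * f (step y (0, -1)).

(** The recursion of first-step analysis, stated without a probability space; [probability_hit_by]
    later identifies it with the probability of reaching the diagonal by time n. *)
Fixpoint hit_prob (R : realType) (l1 l2 m1 m2 : R) (n : nat)
    (y : int * int) : R :=
  if `[< boundaryB y >] then 1
  else if n is n'.+1
    then step_mean l1 l2 m1 m2 (hit_prob l1 l2 m1 m2 n') y else 0.

(* Coordinates on B: a is the distance to the diagonal, b the height. *)
Definition wedge_point (a b : nat) : int * int := ((a + b)%N%:Z, b%:Z).

Lemma regionB_wedge_point (y : int * int) :
  regionB y -> exists a b, y = wedge_point a b.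
Proof.
case: y => -[u|u] [b|b] [] //=; rewrite /half_plane /= => _ bu.
by exists (u - b)%N, b; rewrite /wedge_point subnK.
Qed.

Lemma boundaryB_wedge_point (a b : nat) :
  boundaryB (wedge_point a b) <-> a = 0%N.
Proof.
rewrite /boundaryB /half_plane /=; split=> [[_] /= [] | ->]; last by [].
by move/eqP; rewrite -{2}[b]add0n eqn_add2r => /eqP.
Qed.

Lemma step_half_plane (y j : int * int) : 0 <= (y + j).2 -> step y j = y + j.
Proof. by rewrite /step => h; rewrite mem_set. Qed.

Lemma step_left (a b : nat) :
  step (wedge_point a.+1 b) (-1, 0) = wedge_point a b.
Proof.
have E : wedge_point a.+1 b + (-1, 0) = wedge_point a b.
  by rewrite /wedge_point; congr pair; rewrite /= ?addr0 //; lia.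
by rewrite step_half_plane E.
Qed.

Lemma step_right (a b : nat) :
  step (wedge_point a b) (1, 0) = wedge_point a.+1 b.
Proof.
have E : wedge_point a b + (1, 0) = wedge_point a.+1 b.
  by rewrite /wedge_point; congr pair; rewrite /= ?addr0 //; lia.
by rewrite step_half_plane E.
Qed.

Lemma step_up (a b : nat) :
  step (wedge_point a.+1 b) (0, 1) = wedge_point a b.+1.
Proof.
have E : wedge_point a.+1 b + (0, 1) = wedge_point a b.+1.
  by rewrite /wedge_point; congr pair; rewrite /= ?addr0 //; lia.
by rewrite step_half_plane E.
Qed.

Lemma step_down (a b : nat) :
  step (wedge_point a b.+1) (0, -1) = wedge_point a.+1 b.
Proof.
have E : wedge_point a b.+1 + (0, -1) = wedge_point a.+1 b.
  by rewrite /wedge_point; congr pair; rewrite /= ?addr0 //; lia.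
by rewrite step_half_plane E.
Qed.

Lemma step_down0 (a : nat) :
  step (wedge_point a 0) (0, -1) = wedge_point a 0.
Proof. by rewrite /step memNset. Qed.

Lemma step_mean_interior (R : realType) (l1 l2 m1 m2 : R)
    (f : int * int -> R) (a b : nat) :
  step_mean l1 l2 m1 m2 f (wedge_point a.+1 b.+1) =
  l1 * f (wedge_point a b.+1) + m1 * f (wedge_point a.+2 b.+1) +
  l2 * f (wedge_point a b.+2) + m2 * f (wedge_point a.+2 b).
Proof. by rewrite /step_mean step_left step_right step_up step_down. Qed.

Lemma step_mean_floor (R : realType) (l1 l2 m1 m2 : R)
    (f : int * int -> R) (a : nat) :
  step_mean l1 l2 m1 m2 f (wedge_point a.+1 0) =
  l1 * f (wedge_point a 0) + m1 * f (wedge_point a.+2 0) +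
  l2 * f (wedge_point a 1) + m2 * f (wedge_point a.+1 0).
Proof. by rewrite /step_mean step_left step_right step_up step_down0. Qed.

(** A comparison on B alone suffices: from a point strictly off the diagonal, every step, blocked or
    not, ends in B. *)
Lemma step_mean_le_wedge (R : realType) (l1 l2 m1 m2 : R)
    (l1_ge0 : 0 <= l1) (l2_ge0 : 0 <= l2) (m1_ge0 : 0 <= m1) (m2_ge0 : 0 <= m2)
    (f g : int * int -> R) (a b : nat) :
  (forall a b, f (wedge_point a b) <= g (wedge_point a b)) ->
  step_mean l1 l2 m1 m2 f (wedge_point a.+1 b) <=
  step_mean l1 l2 m1 m2 g (wedge_point a.+1 b).
Proof.
move=> fg; case: b => [|b]; rewrite ?step_mean_floor ?step_mean_interior.
  by rewrite !lerD// ler_wpM2l.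
by rewrite !lerD// ler_wpM2l.
Qed.

Lemma step_meanD (R : realType) (l1 l2 m1 m2 : R) (f g : int * int -> R) y :
  step_mean l1 l2 m1 m2 (f \+ g) y =
  step_mean l1 l2 m1 m2 f y + step_mean l1 l2 m1 m2 g y.
Proof. by rewrite /step_mean /=; ring. Qed.

Lemma step_meanZ (R : realType) (l1 l2 m1 m2 c : R) (f : int * int -> R) y :
  step_mean l1 l2 m1 m2 (fun z => c * f z) y = c * step_mean l1 l2 m1 m2 f y.
Proof. by rewrite /step_mean; ring. Qed.

(** * Comparison of the hitting recursion with a harmonic function *)

Lemma hit_probS_wedge (R : realType) (l1 l2 m1 m2 : R) (n a b : nat) :
  hit_prob l1 l2 m1 m2 n.+1 (wedge_point a.+1 b) =
  step_mean l1 l2 m1 m2 (hit_prob l1 l2 m1 m2 n) (wedge_point a.+1 b).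
Proof. by rewrite /=; case: asboolP => // /boundaryB_wedge_point [].
Qed.

Lemma hit_prob_boundary (R : realType) (l1 l2 m1 m2 : R) (n : nat)
    (y : int * int) : boundaryB y -> hit_prob l1 l2 m1 m2 n y = 1.
Proof. by move=> By; case: n => [|n] /=; rewrite asboolT. Qed.

Lemma hit_prob_sandwich (R : realType) (l1 l2 m1 m2 : R)
    (l1_ge0 : 0 <= l1) (l2_ge0 : 0 <= l2) (m1_ge0 : 0 <= m1) (m2_ge0 : 0 <= m2)
    (h V : int * int -> R) (q : R)
    (q_ge0 : 0 <= q)
    (h_diag : forall b, h (wedge_point 0 b) = 1)
    (h_ge0 : forall a b, 0 <= h (wedge_point a b))
    (h_harm : forall a b, step_mean l1 l2 m1 m2 h (wedge_point a.+1 b) =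
      h (wedge_point a.+1 b))
    (V_ge0 : forall a b, 0 <= V (wedge_point a b))
    (h_le_V : forall a b, h (wedge_point a b) <= V (wedge_point a b))
    (V_super : forall a b, step_mean l1 l2 m1 m2 V (wedge_point a.+1 b) <=
      q * V (wedge_point a.+1 b))
    (n a b : nat) :
  hit_prob l1 l2 m1 m2 n (wedge_point a b) <= h (wedge_point a b) <=
  hit_prob l1 l2 m1 m2 n (wedge_point a b) + q ^+ n * V (wedge_point a b).
Proof.
elim: n a b => [|n IH] [|a] b.
- rewrite hit_prob_boundary ?h_diag ?lexx ?lerDl ?mulr_ge0 ?exprn_ge0//.
(* At time 0 off the diagonal the recursion is 0, so the two bounds are [h_ge0] and [h_le_V]. *)
- rewrite /= asboolF ?expr0 ?mul1r ?add0r ?h_ge0 ?h_le_V//.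
  by case/boundaryB_wedge_point.
- rewrite hit_prob_boundary ?h_diag ?lexx ?lerDl ?mulr_ge0 ?exprn_ge0//.
rewrite hit_probS_wedge -h_harm; apply/andP; split.
  by apply: step_mean_le_wedge => // a' b'; have /andP[] := IH a' b'.
(* Averaging the upper bound at time n and using linearity, the error term [q ^+ n * V] gains one
   factor [q] from [V_super]. *)
apply: (@le_trans _ _ (step_mean l1 l2 m1 m2
    (hit_prob l1 l2 m1 m2 n \+ (fun z => q ^+ n * V z)) (wedge_point a.+1 b))).
  by apply: step_mean_le_wedge => // a' b'; have /andP[] := IH a' b'.
by rewrite step_meanD step_meanZ lerD2l exprSr -mulrA ler_wpM2l ?exprn_ge0.
Qed.

Lemma cvg_hit_prob (R : realType) (l1 l2 m1 m2 : R)
    (l1_ge0 : 0 <= l1) (l2_ge0 : 0 <= l2) (m1_ge0 : 0 <= m1) (m2_ge0 : 0 <= m2)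
    (h V : int * int -> R) (q : R)
    (q_ge0 : 0 <= q) (q_lt1 : q < 1)
    (h_diag : forall b, h (wedge_point 0 b) = 1)
    (h_ge0 : forall a b, 0 <= h (wedge_point a b))
    (h_harm : forall a b, step_mean l1 l2 m1 m2 h (wedge_point a.+1 b) =
      h (wedge_point a.+1 b))
    (V_ge0 : forall a b, 0 <= V (wedge_point a b))
    (h_le_V : forall a b, h (wedge_point a b) <= V (wedge_point a b))
    (V_super : forall a b, step_mean l1 l2 m1 m2 V (wedge_point a.+1 b) <=
      q * V (wedge_point a.+1 b))
    (a b : nat) :
  (hit_prob l1 l2 m1 m2 n (wedge_point a b) : R) @[n --> \oo] -->
    (h (wedge_point a b) : R).
Proof.
have sandwich := hit_prob_sandwich l1_ge0 l2_ge0 m1_ge0 m2_ge0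
  q_ge0 h_diag h_ge0 h_harm V_ge0 h_le_V V_super.
set v := V (wedge_point a b); set hab := h _.
apply: (@squeeze_cvgr _ _ _ _ (fun n => hab - q ^+ n * v) (fun=> hab)).
- apply: nearW => n; rewrite /= /hab /v.
  by have /andP[-> hu] := sandwich n a b; rewrite lerBlDr hu.
- rewrite -[X in _ --> X]subr0; apply: cvgB; first exact: cvg_cst.
  rewrite -[X in _ --> X](mul0r v); apply: cvgMl.
  by apply: cvg_expr; rewrite ger0_norm.
- exact: cvg_cst.
Qed.

(** * Hitting events and their measurability *)

Lemma int2_measurable (A : set (int * int)) : measurable A.
Proof.
apply: countable_measurable; last exact: countableP.
move=> [u v]; rewrite (_ : [set _] = [set u] `*` [set v]); last first.
    by apply/seteqP; split=> [[a b] [-> ->]|[a b] [/= -> ->]].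
  exact: measurableX.
Qed.

Definition hit_by (T : Type) (J : nat -> T -> int * int) (n : nat)
    (y : int * int) : set T :=
  [set w | exists2 k, (k <= n)%N & boundaryB (walk J y k w)].

(** [walk] is defined by appending the last increment; first-step analysis needs the first one
    peeled off instead. *)
Lemma walk_shift (T : Type) (J : nat -> T -> int * int) (y : int * int)
    (k : nat) (w : T) :
  walk J y k.+1 w = walk (fun i => J i.+1) (step y (J 0%N w)) k w.
Proof. by elim: k => //= k <-. Qed.

Lemma hit_by_boundary (T : Type) (J : nat -> T -> int * int) (n : nat)
    (y : int * int) : boundaryB y -> hit_by J n y = setT.
Proof. by move=> By; rewrite -subTset => w _; exists 0%N. Qed.

Lemma hit_by0 (T : Type) (J : nat -> T -> int * int) (y : int * int) :
  ~ boundaryB y -> hit_by J 0 y = set0.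
Proof.
by move=> By; rewrite -subset0 => w [k]; rewrite leqn0 => /eqP ->.
Qed.

Lemma hit_byS (T : Type) (J : nat -> T -> int * int) (n : nat)
    (y : int * int) (w : T) : ~ boundaryB y ->
  hit_by J n.+1 y w <-> hit_by (fun i => J i.+1) n (step y (J 0%N w)) w.
Proof.
move=> By; split=> [[[|k] // kn]|[k kn]].
  by rewrite walk_shift => Bk; exists k.
by rewrite -walk_shift => Bk; exists k.+1.
Qed.

Lemma hit_byS_increment (T : Type) (J : nat -> T -> int * int) (n : nat)
    (y j : int * int) : ~ boundaryB y ->
  hit_by J n.+1 y `&` J 0%N @^-1` [set j] =
  J 0%N @^-1` [set j] `&` hit_by (fun i => J i.+1) n (step y j).
Proof.
by move=> By; apply/seteqP; split=> w [] /=;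
  [move=> + Jj | move=> Jj]; rewrite hit_byS // Jj.
Qed.

(** The position at time k takes countably many values; splitting over them turns the next position
    into a condition on a single increment. *)
Lemma measurable_walk d (T : measurableType d) (J : nat -> T -> int * int)
    (mJ : forall k A, measurable (J k @^-1` A)) (y : int * int) (k : nat)
    (A : set (int * int)) : measurable (walk J y k @^-1` A).
Proof.
elim: k A => [|k IH] A.
  by rewrite preimage_cst; case: ifP.
rewrite (_ : _ @^-1` _ = \bigcup_z (walk J y k @^-1` [set z] `&`
    J k @^-1` [set j | A (step z j)])).
  by apply: countable_bigcupT_measurable => // z; exact: measurableI.
by apply/seteqP; split=> w /=; [exists (walk J y k w) | case=> z _ [/= ->]].
Qed.

Lemma measurable_hit_by d (T : measurableType d) (J : nat -> T -> int * int)
    (mJ : forall k A, measurable (J k @^-1` A)) (n : nat) (y : int * int) :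
  measurable (hit_by J n y).
Proof.
rewrite (_ : hit_by _ _ _ =
    \bigcup_(k in [set k | (k <= n)%N]) (walk J y k @^-1` boundaryB)).
  by apply: bigcup_measurable => k _; exact: measurable_walk.
by apply/seteqP; split=> w [k kn Bk]; exists k.
Qed.

Lemma tau_lt_pinfty (R : realType) (T : Type) (J : nat -> T -> int * int)
    (y : int * int) :
  [set w | (tau R J y w < +oo)%E] = \bigcup_n hit_by J n y.
Proof.
apply/seteqP; split=> w /=.
  by move=> /ereal_inf_lt[_ [k Bk _] _]; exists k => //; exists k.
move=> [n _ [k _ Bk]]; apply: (@le_lt_trans _ _ (k%:R)%:E); last exact: ltry.
by apply: ereal_inf_lbound; exists k.
Qed.

(** * Splitting an event by the value of one increment *)

Lemma probability_split4 d (T : measurableType d) (R : realType)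
    (P : probability T R) (A1 A2 A3 A4 F : set T) :
  measurable A1 -> measurable A2 -> measurable A3 -> measurable A4 ->
  measurable F ->
  A1 `&` A2 = set0 -> A1 `&` A3 = set0 -> A1 `&` A4 = set0 ->
  A2 `&` A3 = set0 -> A2 `&` A4 = set0 -> A3 `&` A4 = set0 ->
  (P A1 + P A2 + P A3 + P A4 = 1)%E ->
  P F = (P (F `&` A1) + P (F `&` A2) + P (F `&` A3) + P (F `&` A4))%E.
Proof.
move=> mA1 mA2 mA3 mA4 mF A12 A13 A14 A23 A24 A34 PA.
have DI (G A B : set T) : A `&` B = set0 -> (G `\` A) `&` B = G `&` B.
  move=> AB; apply/seteqP; split=> w [] => [[Gw nA] Bw //|Gw Bw].
  by split=> //; split=> // Aw; have : set0 w by rewrite -AB.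
have C4 (a b c e : \bar R) : (a + b + c + e = e + c + b + a)%E.
  by rewrite addeC (addeC _ c) (addeC a) !addeA.
have split4 (G : set T) : measurable G -> P G =
    (P (G `\` A1 `\` A2 `\` A3 `\` A4) +
     P (G `&` A4) + P (G `&` A3) + P (G `&` A2) + P (G `&` A1))%E.
  move=> mG.
  have mG1 : measurable (G `\` A1) by exact: measurableD.
  have mG2 : measurable (G `\` A1 `\` A2) by exact: measurableD.
  have mG3 : measurable (G `\` A1 `\` A2 `\` A3) by exact: measurableD.
  rewrite (measureDI P mG mA1) (measureDI P mG1 mA2) (measureDI P mG2 mA3).
  by rewrite (measureDI P mG3 mA4) !(DI _ _ _ A34, DI _ _ _ A24, DI _ _ _ A23,
    DI _ _ _ A12, DI _ _ _ A13, DI _ _ _ A14).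
pose rest (G : set T) := G `\` A1 `\` A2 `\` A3 `\` A4.
have mrest G : measurable G -> measurable (rest G).
  by move=> mG; do 4 apply: measurableD => //.
(* The four events need not cover the space; they have total mass 1, so splitting the whole space
   shows that what they leave out is null. *)
have rest0 : P (rest setT) = 0%E.
  have := split4 setT measurableT; rewrite probability_setT !setTI -/(rest _).
  rewrite -!addeA [X in _ = (_ + X)%E]addeA [X in _ = (_ + X)%E]addeA C4 PA.
  rewrite -[P (rest _)]fineK ?fin_num_measure//; last exact: mrest.
  by case=> rest1; congr EFin; lra.
have restF : P (rest F) = 0%E.
  apply: (@subset_measure0 _ _ _ P _ (rest setT)) => //; [exact: mrest|exact: mrest|].
  by move=> w [[[[]]]].
by rewrite split4 // -/(rest F) restF add0e C4.
Qed.

Lemma increment_split (R : realType) (l1 l2 m1 m2 : R)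
    (sum1 : l1 + l2 + m1 + m2 = 1) d (T : measurableType d)
    (P : probability T R) (X : {RV P >-> (int * int)%type})
    (X_law : increment_law l1 l2 m1 m2 X) (F : set T) :
  measurable F ->
  P F = (P (F `&` X @^-1` [set (-1, 0)%R]) + P (F `&` X @^-1` [set (1, 0)%R]) +
    P (F `&` X @^-1` [set (0, 1)%R]) + P (F `&` X @^-1` [set (0, -1)%R]))%E.
Proof.
have mX A : measurable (X @^-1` A).
  by apply: measurable_funPTI; exact: int2_measurable.
have disj (j j' : int * int) : j != j' ->
    X @^-1` [set j] `&` X @^-1` [set j'] = set0.
  by move=> /eqP jj'; rewrite -subset0 => w [/= -> /jj'].
move=> mF; apply: probability_split4 => //; try exact: disj.
have [] := X_law; rewrite /distribution /pushforward => -> -> -> ->.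
by rewrite -!EFinD; congr EFin; lra.
Qed.

(** * Independence of the increments and the law of the hitting time *)

Definition cylinder (T : Type) (J : nat -> T -> int * int)
    (A : nat -> set (int * int)) (m : nat) : set T :=
  \bigcap_(i in [set i | (i < m)%N]) (J i @^-1` A i).

(** Constraining one more increment yields a longer cylinder, with the sides below m left
    unchanged. *)
Lemma cylinderS (T : Type) (J : nat -> T -> int * int)
    (A : nat -> set (int * int)) (m : nat) (B : set (int * int)) :
  cylinder J A m `&` J m @^-1` B =
  cylinder J (fun i => if i == m then B else A i) m.+1.
Proof.
apply/seteqP; split=> w.
  move=> [Aw Bw] i /=; rewrite ltnS leq_eqVlt.
  by case: eqVneq => [->|_ /= im] //; exact: Aw.
move=> Cw; split; last by have := Cw m (ltnSn m); rewrite /= eqxx.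
by move=> i im; have := Cw i (leqW im); rewrite /= ltn_eqF.
Qed.

Lemma measurable_cylinder d (T : measurableType d) (J : nat -> T -> int * int)
    (mJ : forall k A, measurable (J k @^-1` A)) (A : nat -> set (int * int))
    (m : nat) : measurable (cylinder J A m).
Proof. by apply: bigcap_measurableType => k _; exact: mJ. Qed.

Lemma probability_cylinder (R : realType) d (T : measurableType d)
    (P : probability T R) (J : nat -> {RV P >-> (int * int)%type})
    (J_indep : independent_family J) (A : nat -> set (int * int)) (m : nat) :
  P (cylinder J A m) = (\prod_(i < m) P (J i @^-1` A i))%E.
Proof.
pose I := seq_fset tt (iota 0 m).
have -> : cylinder J A m = \bigcap_(i in [set` I]) (J i @^-1` A i).
  congr bigcap; apply/seteqP; split=> i /=;
  by rewrite seq_fsetE mem_iota.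
rewrite J_indep => [|i _]; last exact: int2_measurable.
(* Independence gives a product over the enumeration of a finite set, in an unspecified order; it is
   a permutation of [iota 0 m]. *)
rewrite (perm_big (iota 0 m)) /=; last first.
  by have := seq_fset_perm tt (iota 0 m); rewrite undup_id ?iota_uniq.
by rewrite -(big_mkord xpredT (fun i => P (J i @^-1` A i))) /index_iota subn0.
Qed.

Lemma probability_cylinderI (R : realType) d (T : measurableType d)
    (P : probability T R) (J : nat -> {RV P >-> (int * int)%type})
    (J_indep : independent_family J) (A : nat -> set (int * int)) (m : nat)
    (B : set (int * int)) :
  P (cylinder J A m `&` J m @^-1` B) =
  (P (cylinder J A m) * P (J m @^-1` B))%E.
Proof.
rewrite cylinderS !probability_cylinder // big_ord_recr /= eqxx.
by congr (_ * _)%E; apply: eq_bigr => i _; rewrite ltn_eqF.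
Qed.

(* Conditioning on a cylinder over the first m increments lets the induction on n peel off the first step without any shift-invariance of the law. *)
Lemma probability_cylinder_hit_by (R : realType) (l1 l2 m1 m2 : R)
    (sum1 : l1 + l2 + m1 + m2 = 1) d (T : measurableType d)
    (P : probability T R) (J : nat -> {RV P >-> (int * int)%type})
    (J_indep : independent_family J)
    (J_law : forall k, increment_law l1 l2 m1 m2 (J k))
    (n m : nat) (A : nat -> set (int * int)) (y : int * int) :
  P (cylinder J A m `&` hit_by (fun i => J (m + i)%N) n y) =
  (P (cylinder J A m) * (hit_prob l1 l2 m1 m2 n y)%:E)%E.
Proof.
have mJ k B : measurable (J k @^-1` B).
  by apply: measurable_funPTI; exact: int2_measurable.
elim: n m A y => [|n IH] m A y; have [By|By] := pselect (boundaryB y).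
- by rewrite hit_by_boundary // hit_prob_boundary // setIT mule1.
- by rewrite hit_by0 // setI0 measure0 /= asboolF // mule0.
- by rewrite hit_by_boundary // hit_prob_boundary // setIT mule1.
have mC := measurable_cylinder mJ A m.
have mH : measurable (hit_by (fun i => J (m + i)%N) n.+1 y).
  by apply: measurable_hit_by => k B; exact: mJ.
rewrite (increment_split sum1 (J_law m)); last exact: measurableI.
(* Once increment m equals j, the walk restarts from [step y j] with the increments from m + 1 on.
   The constraint is absorbed into a cylinder of length m + 1, to which [IH] applies. *)
have term j : P (cylinder J A m `&` hit_by (fun i => J (m + i)%N) n.+1 y `&`
      J m @^-1` [set j]) =
    (P (cylinder J A m) * (P (J m @^-1` [set j]) *
      (hit_prob l1 l2 m1 m2 n (step y j))%:E))%E.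
  have := @hit_byS_increment T (fun i => J (m + i)%N) n y j By.
  rewrite /= addn0 -setIA => ->; rewrite setIA.
  rewrite muleA -probability_cylinderI // cylinderS -IH.
  by congr (P (_ `&` hit_by _ _ _)); apply/funext => i; rewrite addnS.
rewrite !term.
have [] := J_law m; rewrite /distribution /pushforward => -> -> -> ->.
rewrite -[P (cylinder J A m)]fineK ?fin_num_measure//.
rewrite -!EFinM -!EFinD /= asboolF // /step_mean; congr EFin; ring.
Qed.

Lemma probability_hit_by (R : realType) (l1 l2 m1 m2 : R)
    (sum1 : l1 + l2 + m1 + m2 = 1) d (T : measurableType d)
    (P : probability T R) (J : nat -> {RV P >-> (int * int)%type})
    (J_indep : independent_family J)
    (J_law : forall k, increment_law l1 l2 m1 m2 (J k))
    (n : nat) (y : int * int) :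
  P (hit_by J n y) = (hit_prob l1 l2 m1 m2 n y)%:E.
Proof.
have C0 : cylinder J (fun=> setT) 0 = setT by rewrite -subTset => w _ i.
have := probability_cylinder_hit_by sum1 J_indep J_law n 0 (fun=> setT) y.
by rewrite C0 setTI probability_setT mul1e.
Qed.

(** Continuity from below: the events of hitting by time n increase to the event that [tau] is
    finite. *)
Lemma cvg_hit_prob_tau (R : realType) (l1 l2 m1 m2 : R)
    (sum1 : l1 + l2 + m1 + m2 = 1) d (T : measurableType d)
    (P : probability T R) (J : nat -> {RV P >-> (int * int)%type})
    (J_indep : independent_family J)
    (J_law : forall k, increment_law l1 l2 m1 m2 (J k)) (y : int * int) :
  (hit_prob l1 l2 m1 m2 n y)%:E @[n --> \oo] -->
  P [set w | (tau R J y w < +oo)%E].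
Proof.
have mJ k B : measurable (J k @^-1` B).
  by apply: measurable_funPTI; exact: int2_measurable.
have mH n : measurable (hit_by J n y) by exact: measurable_hit_by.
rewrite tau_lt_pinfty.
under eq_fun do rewrite -(probability_hit_by sum1 J_indep J_law).
apply: nondecreasing_cvg_mu => //; first exact: bigcup_measurable.
move=> p q pq; apply/subsetPset => w [k kp Bk].
by exists k => //; exact: leq_trans pq.
Qed.

(** * The candidate formula and its harmonicity *)

Lemma wedge_power (R : realType) (s : R) (a b : nat) :
  s ^ ((wedge_point a b).1 - (wedge_point a b).2) = s ^+ a.
Proof. by rewrite /wedge_point /= PoszD addrK. Qed.

(** The right-hand side of the theorem with a single base [rho]: when rho1 rho2 = r^2, the base r^2
    / rho2 in [bold_h] is rho1 itself. *)
Definition tau_prob (R : realType) (rho r C : R) (y : int * int) : R :=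
  r ^ (y.1 - y.2) - C * r ^ (y.1 - y.2) * rho ^ y.2 + C * rho ^ y.1.

Lemma tau_prob_wedge (R : realType) (rho r C : R) (a b : nat) :
  tau_prob rho r C (wedge_point a b) =
  r ^+ a - C * r ^+ a * rho ^+ b + C * rho ^+ (a + b).
Proof. by rewrite /tau_prob wedge_power. Qed.

Lemma tau_prob_diag (R : realType) (rho r C : R) (b : nat) :
  tau_prob rho r C (wedge_point 0 b) = 1.
Proof. by rewrite tau_prob_wedge expr0 mulr1 add0n subrK. Qed.

Lemma tau_prob_ge0 (R : realType) (rho r C : R) (a b : nat) :
  0 <= r <= rho -> 0 <= C -> 0 <= tau_prob rho r C (wedge_point a b).
Proof.
move=> /andP[r_ge0 r_le] C_ge0; rewrite tau_prob_wedge.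
(* Grouping the two terms carrying [C] exposes the sign: [rho ^+ a - r ^+ a] is nonnegative since r
   <= rho. *)
have -> : r ^+ a - C * r ^+ a * rho ^+ b + C * rho ^+ (a + b) =
    r ^+ a + C * rho ^+ b * (rho ^+ a - r ^+ a) by rewrite exprD; ring.
have rho_ge0 := le_trans r_ge0 r_le.
by rewrite addr_ge0 ?mulr_ge0 ?exprn_ge0 ?subr_ge0 ?lerXn2r.
Qed.

(** Above the floor the three terms r^a, r^a rho1^b and rho1^(a+b) are each harmonic. On the floor
    the last one still is, as it depends only on the first coordinate; the first two fail, and [CE]
    is the value of [C] that cancels their defects. *)
Lemma tau_prob_harmonic (R : realType) (l1 l2 m1 m2 rho1 rho2 r C : R)
    (sum1 : l1 + l2 + m1 + m2 = 1)
    (l1E : l1 = rho1 * m1) (l2E : l2 = rho2 * m2)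
    (l12E : l1 + l2 = r * (m1 + m2)) (r2E : rho1 * rho2 = r ^+ 2)
    (CE : C * (r - rho2) = r * (1 - r)) (a b : nat) :
  step_mean l1 l2 m1 m2 (tau_prob rho1 r C) (wedge_point a.+1 b) =
  tau_prob rho1 r C (wedge_point a.+1 b).
Proof.
(* [r] and [rho1] are the roots other than 1 of the quadratics governing s^(y1 - y2) off the floor
   and s^(y1) respectively. *)
have root_r : l1 + l2 + (m1 + m2) * r ^+ 2 = r.
  rewrite l12E -[RHS]mulr1 -sum1 -addrA l12E; ring.
have root_rho1 : l1 + m1 * rho1 ^+ 2 + (l2 + m2) * rho1 = rho1.
  rewrite -[RHS]mulr1 -sum1 l1E; ring.
have l2rho1 : l2 * rho1 = m2 * r ^+ 2 by rewrite -r2E l2E; ring.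
set x := r ^+ a; set w := rho1 ^+ a.
case: b => [|b]; rewrite ?step_mean_floor ?step_mean_interior !tau_prob_wedge.
  (* The two sides are the floor defects of r^a and of C r^a rho1^b: they equal m2 r (1 - r) and C
     m2 (r - rho2). *)
  have floor_balance :
      l1 + m1 * r ^+ 2 + l2 + m2 * r - r =
      C * (l1 + m1 * r ^+ 2 + l2 * rho1 + m2 * r - r).
    have e1 : l1 + m1 * r ^+ 2 + l2 + m2 * r - r = m2 * (r * (1 - r)).
      by rewrite -{3}root_r; ring.
    have e2 : l1 + m1 * r ^+ 2 + l2 * rho1 + m2 * r - r = m2 * (r - rho2).
      by rewrite -{3}root_r l2rho1 l2E; ring.
    by rewrite e1 e2 -CE; ring.
  rewrite !addn0 addn1 !exprS expr0 -/x -/w.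
  transitivity (r * x - C * (r * x) + C * (rho1 * w) +
    x * ((l1 + m1 * r ^+ 2 + l2 + m2 * r - r) -
      C * (l1 + m1 * r ^+ 2 + l2 * rho1 + m2 * r - r)) +
    C * w * (l1 + m1 * rho1 ^+ 2 + (l2 + m2) * rho1 - rho1)); first by ring.
  by rewrite floor_balance root_rho1; ring.
rewrite !addSn !addnS !exprS !exprD -/x -/w; set z := rho1 ^+ b.
transitivity (x * (l1 + l2 + (m1 + m2) * r ^+ 2) -
  C * x * z * ((l1 + m1 * r ^+ 2) * rho1 + l2 * rho1 * rho1 + m2 * r ^+ 2) +
  C * w * z * rho1 * (l1 + m1 * rho1 ^+ 2 + (l2 + m2) * rho1)); first by ring.
(* Harmonicity of r^a rho1^b: [l2rho1] exchanges the weights of the up and down steps, reducing it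
   to the equation for [r]. *)
have -> : (l1 + m1 * r ^+ 2) * rho1 + l2 * rho1 * rho1 + m2 * r ^+ 2 =
    rho1 * (l1 + l2 + (m1 + m2) * r ^+ 2).
  transitivity (rho1 * (l1 + m1 * r ^+ 2) + m2 * r ^+ 2 * rho1 + l2 * rho1).
    by rewrite l2rho1; ring.
  ring.
by rewrite root_r root_rho1; ring.
Qed.

(** * The contracted majorant *)

Definition lyapunov (R : realType) (s M : R) (y : int * int) : R :=
  s ^ (y.1 - y.2) + M * s ^ y.1.

Lemma lyapunov_wedge (R : realType) (s M : R) (a b : nat) :
  lyapunov s M (wedge_point a b) = s ^+ a + M * s ^+ (a + b).
Proof. by rewrite /lyapunov wedge_power. Qed.

Lemma lyapunov_super (R : realType) (l1 l2 m1 m2 s M q : R)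
    (l1_ge0 : 0 <= l1) (l2_ge0 : 0 <= l2) (m1_ge0 : 0 <= m1) (m2_ge0 : 0 <= m2)
    (sum1 : l1 + l2 + m1 + m2 = 1) (s01 : 0 <= s <= 1) (q_ge0 : 0 <= q)
    (M_ge0 : 0 <= M)
    (contr_diag : l1 + l2 + (m1 + m2) * s ^+ 2 <= q * s)
    (contr_horiz : M * (l1 + m1 * s ^+ 2 + (l2 + m2) * s) + 1 <= M * (q * s))
    (a b : nat) :
  step_mean l1 l2 m1 m2 (lyapunov s M) (wedge_point a.+1 b) <=
  q * lyapunov s M (wedge_point a.+1 b).
Proof.
have /andP[s_ge0 s_le1] := s01.
have x_ge0 : 0 <= s ^+ a by rewrite exprn_ge0.
have y_ge0 : 0 <= s ^+ b by rewrite exprn_ge0.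
case: b y_ge0 => [|b] y_ge0;
  rewrite ?step_mean_floor ?step_mean_interior !lyapunov_wedge.
  have s2_le1 : s ^+ 2 <= 1 by rewrite exprn_ile1.
  (* A crude bound for the mean of s^(y1 - y2) at the floor, where a down step is blocked; the [+ 1]
     in [contr_horiz] pays for it. *)
  have floor_le1 : l1 + m1 * s ^+ 2 + l2 + m2 * s <= 1.
    have := ler_wpM2l m1_ge0 s2_le1; have := ler_wpM2l m2_ge0 s_le1; lra.
  rewrite !addn0 addn1 !exprS; set x := s ^+ a in x_ge0 *.
  rewrite -subr_ge0 (_ : _ - _ = x * ((M * (q * s) -
    M * (l1 + m1 * s ^+ 2 + (l2 + m2) * s)) -
    (l1 + m1 * s ^+ 2 + l2 + m2 * s) + q * s)); last by ring.
  have qs_ge0 : 0 <= q * s by rewrite mulr_ge0.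
  by apply: mulr_ge0 => //; lra.
rewrite !addSn !addnS !exprS !exprD; move: x_ge0 y_ge0.
rewrite exprS; set x := s ^+ a; set z := s ^+ b => x_ge0 sz_ge0.
rewrite -subr_ge0 (_ : _ - _ =
  x * (q * s - (l1 + l2 + (m1 + m2) * s ^+ 2)) +
  x * (s * z) * (M * (q * s) - M * (l1 + m1 * s ^+ 2 + (l2 + m2) * s)));
  last by ring.
apply: addr_ge0; apply: mulr_ge0; rewrite ?(mulr_ge0 x_ge0) //; lra.
Qed.

Lemma lyapunov_parameters (R : realType) (l1 l2 m1 m2 rho1 r C : R)
    (l1_ge0 : 0 <= l1) (l2_ge0 : 0 <= l2) (m1_gt0 : 0 < m1) (m2_gt0 : 0 < m2)
    (sum1 : l1 + l2 + m1 + m2 = 1)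
    (l1E : l1 = rho1 * m1) (l12E : l1 + l2 = r * (m1 + m2))
    (r_le : r <= rho1) (rho1_ge0 : 0 <= rho1) (rho1_lt1 : rho1 < 1) :
  exists s M q, [/\ rho1 <= s <= 1, C <= M /\ 0 <= M, 0 <= q < 1,
    l1 + l2 + (m1 + m2) * s ^+ 2 <= q * s &
    M * (l1 + m1 * s ^+ 2 + (l2 + m2) * s) + 1 <= M * (q * s)].
Proof.
(* Any point strictly between rho1 and 1 serves: since r <= rho1, it lies strictly between the roots
   of both quadratics, so [A] and [B] are both below [s]. *)
pose s := (rho1 + 1) / 2.
have [rho1_lt_s s_lt1] : rho1 < s /\ s < 1 by rewrite /s; split; lra.
pose A := l1 + l2 + (m1 + m2) * s ^+ 2.
pose B := l1 + m1 * s ^+ 2 + (l2 + m2) * s.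
have A_lt_s : A < s.
  rewrite -subr_gt0 (_ : _ - _ = (1 - s) * (m1 + m2) * (s - r)).
    by rewrite !mulr_gt0 ?subr_gt0 ?addr_gt0 // (le_lt_trans r_le).
  transitivity (s * (l1 + l2 + m1 + m2) - A); first by rewrite sum1 mulr1.
  by rewrite /A l12E; ring.
have B_lt_s : B < s.
  rewrite -subr_gt0 (_ : _ - _ = (1 - s) * m1 * (s - rho1)).
    by rewrite !mulr_gt0 ?subr_gt0.
  transitivity (s * (l1 + l2 + m1 + m2) - B); first by rewrite sum1 mulr1.
  by rewrite /B l1E; ring.
have A_ge0 : 0 <= A by rewrite /A !addr_ge0 // mulr_ge0 ?sqr_ge0 // addr_ge0 ?ltW.
have [q [q_ge0 q_lt1 A_le B_lt]] : exists q, [/\ 0 <= q, q < 1,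
    A <= q * s & B < q * s].
  have s_gt0 : 0 < s by exact: le_lt_trans rho1_lt_s.
  have : Num.max A B / s < 1 by rewrite ltr_pdivrMr // mul1r gt_max A_lt_s.
  (* [q] is the midpoint of max(A, B) / s and 1, leaving strict room in both contractions. *)
  move=> /midf_lt; set q := (_ / 2) => -[lt_q q_lt1]; exists q.
  move: lt_q; rewrite ltr_pdivrMr // gt_max => /andP[A_lt B_lt].
  split=> //; last exact: ltW.
  by rewrite -(pmulr_lge0 _ s_gt0) (le_trans A_ge0) // ltW.
(* M >= C makes the majorant dominate the candidate; M >= 1 / (q s - B) provides the unit of slack
   for the floor. *)
exists s, (Num.max C (q * s - B)^-1), q.
have gap : 0 < q * s - B by rewrite subr_gt0.
have M_ge : (q * s - B)^-1 <= Num.max C (q * s - B)^-1 by rewrite le_max lexx orbT.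
split; rewrite -/A -/B ?q_ge0 //.
- by rewrite !ltW.
- by split; [rewrite le_max lexx | rewrite (le_trans _ M_ge) // invr_ge0 ltW].
rewrite addrC -lerBrDr -mulrBr -ler_pdivrMr // mul1r //.
Qed.

(** Term by term: the subtracted term is dropped, and [s] dominates both [r] and [rho1]. *)
Lemma tau_prob_le_lyapunov (R : realType) (rho1 r C s M : R)
    (r_ge0 : 0 <= r) (r_le : r <= rho1) (rho1_le : rho1 <= s)
    (C_ge0 : 0 <= C) (C_le : C <= M) (a b : nat) :
  tau_prob rho1 r C (wedge_point a b) <= lyapunov s M (wedge_point a b).
Proof.
have rho1_ge0 := le_trans r_ge0 r_le.
have s_ge0 := le_trans rho1_ge0 rho1_le.
rewrite tau_prob_wedge lyapunov_wedge; apply: lerD.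
  rewrite lerBlDr (le_trans (y := s ^+ a)) //.
    by rewrite lerXn2r ?nnegrE // (le_trans r_le).
  by rewrite lerDl !mulr_ge0 ?exprn_ge0.
by apply: ler_pM; rewrite ?exprn_ge0 ?lerXn2r ?nnegrE.
Qed.

Theorem proposition7p2 (R : realType)
  (lambda1 lambda2 mu1 mu2 rho1 rho2 r : R)
  (lambda1_gt0 : 0 < lambda1) (lambda2_gt0 : 0 < lambda2)
  (mu1_gt0 : 0 < mu1) (mu2_gt0 : 0 < mu2)
  (sum1 : lambda1 + lambda2 + mu1 + mu2 = 1)
  (rho1E : rho1 = lambda1 / mu1) (rho2E : rho2 = lambda2 / mu2)
  (rE : r = (lambda1 + lambda2) / (mu1 + mu2))
  (rho1_lt1 : rho1 < 1) (rho2_lt1 : rho2 < 1)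
  (rho2_le_r : rho2 <= r) (r_le_rho1 : r <= rho1) (rho12 : rho1 <> rho2)
  (r2_rho2 : r ^+ 2 / rho2 < 1)
  (d : measure_display) (T : measurableType d) (P : probability T R)
  (J : nat -> {RV P >-> (int * int)%type})
  (J_indep : independent_family J)
  (J_law : forall k : nat, increment_law lambda1 lambda2 mu1 mu2 (J k))
  (rho1rho2 : rho1 * rho2 = r ^+ 2)
  (y : int * int) (yB : regionB y) :
  P [set w | (tau R J y w < +oo)%E] =
  (bold_h rho2 r y + (1 - r) / (1 - rho2 / r) * h_rho rho1 y)%:E.
Proof.
set C := (1 - r) / (1 - rho2 / r).
have mu12_gt0 : 0 < mu1 + mu2 by exact: addr_gt0.
have r_gt0 : 0 < r by rewrite rE divr_gt0 // addr_gt0.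
have rho2_gt0 : 0 < rho2 by rewrite rho2E divr_gt0.
have rho2_lt_r : rho2 < r.
  (* If rho2 = r, then rho1 rho2 = r^2 forces rho1 = r = rho2. Strictness makes the denominator of
     [C] positive. *)
  rewrite lt_neqAle rho2_le_r andbT; apply/eqP => rho2r; apply: rho12.
  by apply: (mulIf (lt0r_neq0 r_gt0)); rewrite -{1}rho2r rho1rho2 rho2r.
have r_lt1 : r < 1 by exact: le_lt_trans rho1_lt1.
have den_gt0 : 0 < 1 - rho2 / r by rewrite subr_gt0 ltr_pdivrMr // mul1r.
have C_ge0 : 0 <= C by rewrite ltW // divr_gt0 // subr_gt0.
have CE : C * (r - rho2) = r * (1 - r).
  have -> : r - rho2 = r * (1 - rho2 / r) by rewrite mulrBr mulrCA divff ?mulr1 ?gt_eqF.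
  by rewrite mulrCA /C divfK // gt_eqF.
have l1E : lambda1 = rho1 * mu1 by rewrite rho1E divfK ?gt_eqF.
have l2E : lambda2 = rho2 * mu2 by rewrite rho2E divfK ?gt_eqF.
have l12E : lambda1 + lambda2 = r * (mu1 + mu2) by rewrite rE divfK ?gt_eqF.
have r_ge0 := ltW r_gt0; have rho1_ge0 := le_trans r_ge0 r_le_rho1.
have -> : bold_h rho2 r y + C * h_rho rho1 y = tau_prob rho1 r C y.
  by rewrite /bold_h /h_rho /tau_prob -rho1rho2 mulfK ?gt_eqF.
have [s [M [q [/andP[rho1_le s_le1] [C_le M_ge0] /andP[q_ge0 q_lt1] diag horiz]]]] :=
  lyapunov_parameters C (ltW lambda1_gt0) (ltW lambda2_gt0) mu1_gt0 mu2_gt0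
    sum1 l1E l12E r_le_rho1 rho1_ge0 rho1_lt1.
have s_ge0 := le_trans rho1_ge0 rho1_le.
have [a [b ->]] := regionB_wedge_point yB.
have hit_cvg : (hit_prob lambda1 lambda2 mu1 mu2 n (wedge_point a b) : R)
    @[n --> \oo] --> (tau_prob rho1 r C (wedge_point a b) : R).
  apply: (@cvg_hit_prob _ _ _ _ _ (ltW lambda1_gt0) (ltW lambda2_gt0)
    (ltW mu1_gt0) (ltW mu2_gt0) (tau_prob rho1 r C) (lyapunov s M) q) => //.
  - exact: tau_prob_diag.
  - by move=> a' b'; rewrite tau_prob_ge0 // r_ge0.
  - exact: tau_prob_harmonic sum1 l1E l2E l12E rho1rho2 CE.
  - by move=> a' b'; rewrite lyapunov_wedge addr_ge0 ?mulr_ge0 ?exprn_ge0.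
  - by move=> a' b'; exact: tau_prob_le_lyapunov.
  - by move=> a' b'; apply: lyapunov_super; rewrite ?s_ge0 // ltW.
have tau_cvg := cvg_hit_prob_tau sum1 J_indep J_law (y := wedge_point a b).
(* The same sequence tends to the probability and to the candidate. *)
apply: (cvg_unique _ tau_cvg) => //.
by apply: cvg_EFin hit_cvg; exact: nearW.
Qed.
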